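(* Let $D$ be a database and let $\Sigma$ be a finite set of guarded TGDs. Then: (1) $\Sigma\in\mathsf{CT}_D$ if and only if $\mathsf{lin}(\Sigma)\in\mathsf{CT}_{\mathsf{lin}(D)}$; that is, $\mathsf{chase}(D,\Sigma)$ is finite if and only if $\mathsf{chase}(\mathsf{lin}(D),\mathsf{lin}(\Sigma))$ is finite. (2) $\mathsf{maxdepth}(D,\Sigma)=\mathsf{maxdepth}(\mathsf{lin}(D),\mathsf{lin}(\Sigma))$.
   Context: **Basics.** $\mathbf{C},\mathbf{N},\mathbf{V}$ are disjoint countably infinite sets of constants, nulls and variables; their elements are terms. A schema is a finite set of predicates, each with an arity $>0$. An atom is $R(\bar t)$ with $\bar t$ a tuple of terms of length the arity of $R$; a fact is an atom with only constants. An instance is a (possibly infinite) set of atoms over constants and nulls; a database is a finite set of facts; $\mathsf{dom}(\cdot)$ denotes the set of terms occurring in an instance or atom. A homomorphism from a set of atoms $A$ to a set of atoms $B$ maps terms of $A$ to terms of $B$, is the identity on $\mathbf{C}$, and maps atoms of $A$ to atoms of $B$. **TGDs.** A TGD $\sigma$ is a constant-free sentence $\forall\bar x\forall\bar y(\phi(\bar x,\bar y)\to\exists\bar z\,\psi(\bar x,\bar z))$ with $\phi$ (the body) and $\psi$ (the head) non-empty conjunctions of atoms over the variables $\bar x\cup\bar y$ and $\bar x\cup\bar z$; conjunctions are identified with sets of atoms. The frontier $\mathsf{fr}(\sigma)$ is the set of variables $\bar x$ occurring in both body and head. A TGD is guarded if some body atom contains all variables of the body; the leftmost such atom is $\mathsf{guard}(\sigma)$.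 A TGD is linear if its body is a single atom. For a finite set $\Sigma$ of TGDs (no two sharing a variable, w.l.o.g.), $\mathsf{sch}(\Sigma)$ is the set of predicates occurring in $\Sigma$ and $\mathsf{ar}(\Sigma)$ their maximum arity. **Semi-oblivious chase.** A trigger for $\Sigma$ on an instance $I$ is $(\sigma,h)$ with $\sigma\in\Sigma$ and $h$ a homomorphism from $\mathsf{body}(\sigma)$ to $I$. Its result $\mathsf{result}(\sigma,h)$ is $\mu(\mathsf{head}(\sigma))$, where $\mu(x)=h(x)$ if $x\in\mathsf{fr}(\sigma)$ and otherwise $\mu(x)$ is the null $\bot^x_{\sigma,h_{|\mathsf{fr}(\sigma)}}$, uniquely determined by $x$, $\sigma$ and the restriction of $h$ to $\mathsf{fr}(\sigma)$. The trigger is active if $\mathsf{result}(\sigma,h)\not\subseteq I$; applying it yields $I\cup\mathsf{result}(\sigma,h)$. A valid chase derivation of $D$ w.r.t. $\Sigma$ is a sequence of instances starting with $D$, each next one obtained by applying an active trigger, that is either finite with no active trigger on the last instance, or infinite and fair (every trigger active on some $I_i$ is not active on some later $I_j$). Its result is the union of its instances; all valid derivations have the same result, denoted $\mathsf{chase}(D,\Sigma)$. $\mathsf{CT}_D$ is the class of sets $\Sigma$ of TGDs such that $\mathsf{chase}(D,\Sigma)$ is finite. **Depth.** For $t\in\mathsf{dom}(\mathsf{chase}(D,\Sigma))$: $\mathsf{depth}(t)=0$ if $t$ is a constant, and $\mathsf{depth}(\bot^z_{\sigma,h})=1+\max(\{\mathsf{depth}(h(x))\mid x\in\mathsf{fr}(\sigma)\}\cup\{0\})$.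 $\mathsf{maxdepth}(D,\Sigma)$ is the maximum depth of terms in $\mathsf{dom}(\mathsf{chase}(D,\Sigma))$, and is $\infty$ if $\mathsf{chase}(D,\Sigma)$ is infinite. **Linearization.** Positive integers are treated as constants. For tuples, $\bar t\simeq\bar u$ means they have the same length $n$ and $t_i=t_j$ iff $u_i=u_j$ for all $i,j\in\{1,\ldots,n\}$. For $\alpha\in\mathsf{chase}(D,\Sigma)$, $\mathsf{type}_{D,\Sigma}(\alpha)=\{\beta\in\mathsf{chase}(D,\Sigma)\mid\mathsf{dom}(\beta)\subseteq\mathsf{dom}(\alpha)\}$. $\mathsf{complete}(D,\Sigma)=\{\alpha\in\mathsf{chase}(D,\Sigma)\mid\mathsf{dom}(\alpha)\subseteq\mathsf{dom}(D)\}$. A $\Sigma$-type $\tau$ is a pair $(\alpha,T)$ where $\alpha=R(t_1,\ldots,t_n)$ with $R\in\mathsf{sch}(\Sigma)$, the $t_i$ integers with $t_1=1$ and $1\le t_i\le\max_{j<i}t_j+1$ for $i\ge2$, and $T$ is a set of atoms with predicates from $\mathsf{sch}(\Sigma)$ and terms from $\mathsf{dom}(\alpha)$, with $\alpha\notin T$. Put $\mathsf{guard}(\tau)=\alpha$ and $\mathsf{atoms}(\tau)=T\cup\{\alpha\}$. For $\bar u\simeq(t_1,\ldots,t_n)$, $\tau(\bar u)$ is obtained from $\mathsf{atoms}(\tau)$ by replacing each $t_i$ with $u_i$. For each $\Sigma$-type $\tau$, $[\tau]$ is a new predicate with the arity of the predicate of $\mathsf{guard}(\tau)$. *Database:* $\mathsf{lin}(D)$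 (which depends also on $\Sigma$) is the set of all $[\tau](\bar t)$ such that $R(\bar t)\in D$, $\tau$ is a $\Sigma$-type with $\mathsf{guard}(\tau)=R(\bar u)$ for some $\bar u\simeq\bar t$, and $\tau(\bar t)=\mathsf{type}_{D,\Sigma}(R(\bar t))$. *TGDs:* Let $\sigma\in\Sigma$ be $\varphi(\bar x,\bar y)\to\exists z_1\cdots\exists z_n\,R_1(\bar u_1),\ldots,R_m(\bar u_m)$ with $\mathsf{guard}(\sigma)=R(\bar u)$ and frontier $\bar x$. Let $\tau$ be a $\Sigma$-type and $h$ a homomorphism from $\varphi(\bar x,\bar y)$ to $\mathsf{atoms}(\tau)$ with $h(R(\bar u))=\mathsf{guard}(\tau)$. The linearization of $\sigma$ induced by $\tau$ and $h$ is the linear TGD $[\tau](\bar u)\to\exists z_1\cdots\exists z_n\,[\tau_1](\bar u_1),\ldots,[\tau_m](\bar u_m)$, where the $\tau_i$ are as follows. Let $f(t)=h(t)$ for $t\in\bar x$ and $f(z_i)=\mathsf{ar}(\Sigma)+i$; let $\alpha_i=R_i(f(\bar u_i))$, $I=\{\alpha_1,\ldots,\alpha_m\}\cup\mathsf{atoms}(\tau)$, and $T_i=\{\beta\in\mathsf{complete}(I,\Sigma)\mid\mathsf{dom}(\beta)\subseteq\mathsf{dom}(\alpha_i)\}\setminus\{\alpha_i\}$. Let $\rho$ rename the integers of $\alpha_i$ by order of first occurrence in $\alpha_i$, starting from $1$ (e.g. $R(2,2,4,1)$ becomes $R(1,1,2,3)$); then $\tau_i=(\rho(\alpha_i),\rho(T_i))$.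 $\mathsf{lin}(\sigma)$ is the set of all linearizations of $\sigma$ over all such $\tau,h$, and $\mathsf{lin}(\Sigma)=\bigcup_{\sigma\in\Sigma}\mathsf{lin}(\sigma)$.
   Formalization: In lin(D), the type of a fact of D is restricted to its atoms over sch(Σ) before being compared with τ; this changes nothing if D is over sch(Σ), and without it the claim fails, e.g. for D={R(a,b),S(a)}, Σ={R(x,y)→∃z R(y,z)}. *)

(* Defs.v *)
From HB Require Import structures.
From mathcomp Require Import all_boot finmap.
From mathcomp Require Import all_classical.

Set Implicit Arguments.
Unset Strict Implicit.
Unset Printing Implicit Defensive.

Local Open Scope classical_set_scope.

(* Constants and variables are two copies of [nat]; the positive integers used
   to describe Sigma-types and linearizations are thus literally constants. *)
Definition const := nat.
Definition var := nat.

Record atom (P T : Type) := Atom { psym : P; args : seq T }.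

Definition amap (P T U : Type) (f : T -> U) (a : atom P T) : atom P U :=
  Atom (psym a) (map f (args a)).

Definition atom_pair (P T : Type) (a : atom P T) := (psym a, args a).
Definition pair_atom (P T : Type) (a : P * seq T) := Atom a.1 a.2.
Lemma atom_pairK (P T : Type) : cancel (@atom_pair P T) (@pair_atom P T).
Proof. by case. Qed.

HB.instance Definition _ (P T : eqType) :=
  Equality.copy (atom P T) (can_type (@atom_pairK P T)).
HB.instance Definition _ (P T : choiceType) :=
  Choice.copy (atom P T) (can_type (@atom_pairK P T)).

(* The arity of predicates is a function [ar], and atoms are not constrained by
   their type to respect it: see [atom_wf]. *)
Definition atom_wf (P T : Type) (ar : P -> nat) (a : atom P T) : bool :=
  size (args a) == ar (psym a).

(* Bodies and heads are lists because guard(sigma) is the leftmost guard; the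
   variables of the head that do not occur in the body are the existentially
   quantified ones. *)
Record tgd (P : Type) :=
  Tgd { tgd_body : seq (atom P var); tgd_head : seq (atom P var) }.

Definition tgd_pair (P : Type) (s : tgd P) := (tgd_body s, tgd_head s).
Definition pair_tgd (P : Type) (s : seq (atom P var) * seq (atom P var)) :=
  Tgd s.1 s.2.
Lemma tgd_pairK (P : Type) : cancel (@tgd_pair P) (@pair_tgd P).
Proof. by case. Qed.

HB.instance Definition _ (P : eqType) :=
  Equality.copy (tgd P) (can_type (@tgd_pairK P)).
HB.instance Definition _ (P : choiceType) :=
  Choice.copy (tgd P) (can_type (@tgd_pairK P)).

(* [Null x s v] is the null indexed by the variable [x], the TGD [s] and the
   function from fr(s) to terms whose list of values along [fr s] is [v]. *)
Inductive term (P : Type) : Type :=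
  | Const of const
  | Null of var & tgd P & seq (term P).
Arguments Const {P}.

HB.instance Definition _ (P : Type) := gen_eqMixin (term P).
HB.instance Definition _ (P : Type) := gen_choiceMixin (term P).

Notation fact P := (atom P const).
Notation instance P := (set (atom P (term P))).

Definition dom (P : Type) (T : eqType) (a : atom P T) : set T := [set` args a].

Definition idom (P : Type) (T : eqType) (I : set (atom P T)) : set T :=
  \bigcup_(a in I) dom a.

(* A set of facts, seen as an instance. *)
Definition inst_of (P : Type) (D : set (fact P)) : instance P :=
  [set amap Const a | a in D].

Definition is_database (P : choiceType) (ar : P -> nat) (D : {fset fact P}) : Prop :=
  forall a, a \in D -> atom_wf ar a.

Section Tgds.
Variable P : choiceType.
Implicit Types (s : tgd P) (ar : P -> nat) (Sigma : {fset tgd P}).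

Definition vars (A : seq (atom P var)) : seq var := flatten (map (@args P var) A).

Definition tgd_wf ar s : bool :=
  [&& tgd_body s != [::], tgd_head s != [::] & all (atom_wf ar) (tgd_body s ++ tgd_head s)].

Definition fr s : seq var := [seq x <- undup (vars (tgd_body s)) | x \in vars (tgd_head s)].

Definition exvars s : seq var :=
  [seq x <- undup (vars (tgd_head s)) | x \notin vars (tgd_body s)].

Definition is_guard s (a : atom P var) : bool :=
  all (fun x => x \in args a) (vars (tgd_body s)).

Definition guarded s : bool := has (is_guard s) (tgd_body s).

Definition guard s : option (atom P var) :=
  ohead [seq a <- tgd_body s | is_guard s a].

Definition sch Sigma : seq P :=
  [seq psym a | s <- enum_fset Sigma, a <- tgd_body s ++ tgd_head s].

Definition max_ar ar Sigma : nat := \max_(p <- sch Sigma) ar p.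

End Tgds.

(* Sets of TGDs are arbitrary here; only the values of [h] on the variables of
   the body matter. *)
Section Chase.
Variable P : choiceType.
Implicit Types (D : set (fact P)) (Sigma : set (tgd P)) (I J : instance P).
Implicit Types (s : tgd P) (h : var -> term P).

Definition trigger Sigma I s h : Prop :=
  Sigma s /\ forall a, a \in tgd_body s -> I (amap h a).

Definition mu s h (x : var) : term P :=
  if x \in fr s then h x else Null x s (map h (fr s)).

Definition result s h : instance P := [set amap (mu s h) a | a in [set` tgd_head s]].

Definition active Sigma I s h : Prop := trigger Sigma I s h /\ ~ result s h `<=` I.

Definition chase_step Sigma I J : Prop :=
  exists s h, active Sigma I s h /\ J = I `|` result s h.

Definition finite_derivation D Sigma (n : nat) (C : nat -> instance P) : Prop :=
  [/\ C 0 = inst_of D,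
      forall i, i < n -> chase_step Sigma (C i) (C i.+1) &
      forall s h, ~ active Sigma (C n) s h].

Definition infinite_derivation D Sigma (C : nat -> instance P) : Prop :=
  [/\ C 0 = inst_of D,
      forall i, chase_step Sigma (C i) (C i.+1) &
      forall i s h, active Sigma (C i) s h ->
        exists j, i < j /\ ~ active Sigma (C j) s h].

Definition derivation_result D Sigma (J : instance P) : Prop :=
  (exists n C, finite_derivation D Sigma n C /\ J = \bigcup_(i in `I_n.+1) C i) \/
  (exists C, infinite_derivation D Sigma C /\ J = \bigcup_i C i).

(* All valid derivations have the same result, so the union of their results is
   that common result. *)
Definition chase D Sigma : instance P := \bigcup_(J in derivation_result D Sigma) J.

Definition CT D : set (set (tgd P)) := [set Sigma | finite_set (chase D Sigma)].

Fixpoint depth (t : term P) : nat :=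
  if t is Null _ _ v then (foldr (fun u m => maxn (depth u) m) 0 v).+1 else 0.

(* [None] stands for infinity; the maximum over no term at all is 0. *)
Definition maxdepth D Sigma : option nat :=
  if `[< finite_set (chase D Sigma) >]
  then Some (\max_(t <- fset_set (idom (chase D Sigma))) depth t)
  else None.

Definition type_of D Sigma (a : atom P (term P)) : instance P :=
  [set b | chase D Sigma b /\ dom b `<=` dom a].

Definition complete D Sigma : instance P :=
  [set b | chase D Sigma b /\ dom b `<=` idom (inst_of D)].

End Chase.

(* The pairs (alpha, T), among which [is_stype] singles out the Sigma-types. A
   pair tau is used directly as the new predicate [tau], whose arity is that of
   the predicate of its guard. *)
Definition stype (P : choiceType) : Type := (fact P * {fset fact P})%type.

HB.instance Definition _ (P : choiceType) :=
  Choice.copy (stype P) (fact P * {fset fact P})%type.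

Section Linearization.
Variables (P : choiceType) (ar : P -> nat).
Implicit Types (Sigma : {fset tgd P}) (s : tgd P) (t : stype P).

Definition tguard t : fact P := t.1.

Definition tatoms t : {fset fact P} := (tguard t |` t.2)%fset.

Definition is_stype Sigma t : Prop :=
  let u := args (tguard t) in
  [/\ atom_wf ar (tguard t) /\ psym (tguard t) \in sch Sigma,
      nth 0 u 0 = 1,
      forall i, 0 < i < size u -> 1 <= nth 0 u i <= (\max_(k <- take i u) k).+1,
      forall b, b \in t.2 ->
        [/\ atom_wf ar b, psym b \in sch Sigma & dom b `<=` dom (tguard t)] &
      tguard t \notin t.2].

Definition same_pattern (T U : eqType) (u : seq T) (v : seq U) : Prop :=
  size u = size v /\
  forall x0 y0 i j, i < size u -> j < size u ->
    (nth x0 u i = nth x0 u j) <-> (nth y0 v i = nth y0 v j).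

(* tau(u), for u with the same pattern as the arguments of guard(tau). *)
Definition inst_type t (u : seq (term P)) : instance P :=
  [set amap (fun k => nth (Const 0) u (index k (args (tguard t)))) b
     | b in [set` tatoms t]].

(* Sigma-types only have atoms over sch(Sigma), so the type of a fact of D is
   compared with tau after discarding its atoms over other predicates; there are
   none when D itself is over sch(Sigma). *)
Definition lin_db (D : set (fact P)) Sigma : set (fact (stype P)) :=
  [set b | exists a t,
     [/\ D a, is_stype Sigma t, psym (tguard t) = psym a,
         same_pattern (args (tguard t)) (args a) &
         inst_type t (map Const (args a)) =
           type_of D [set` Sigma] (amap Const a)
             `&` [set c | psym c \in sch Sigma]] /\
     b = Atom t (args a)].

(* Renaming of the integers of [u] by order of first occurrence, from 1. *)
Definition rho (u : seq nat) (k : nat) : nat :=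
  (size (undup (take (index k u) u))).+1.

Definition lin_f Sigma s (h : var -> nat) (x : var) : nat :=
  if x \in fr s then h x else max_ar ar Sigma + (index x (exvars s)).+1.

Definition lin_inst Sigma s t (h : var -> nat) : set (fact P) :=
  [set amap (lin_f Sigma s h) a | a in [set` tgd_head s]] `|` [set` tatoms t].

(* The set below is finite, as it ranges over the atoms with arguments in
   dom(alpha) and predicates in the finite set sch(Sigma); all the atoms of
   [complete] over dom(alpha) have only constants as arguments. *)
Definition lin_side Sigma s t (h : var -> nat) (alpha : fact P) : {fset fact P} :=
  fset_set ([set b | complete (lin_inst Sigma s t h) [set` Sigma] (amap Const b)
                     /\ dom b `<=` dom alpha] `\ alpha).

Definition lin_type Sigma s t (h : var -> nat) (a : atom P var) : stype P :=
  let alpha := amap (lin_f Sigma s h) a in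
  let r := amap (rho (args alpha)) in
  (r alpha, [fset r b | b in lin_side Sigma s t h alpha]%fset).

Definition linearization Sigma s t (h : var -> nat) (g : atom P var) :
    tgd (stype P) :=
  Tgd [:: Atom t (args g)]
      [seq Atom (lin_type Sigma s t h a) (args a) | a <- tgd_head s].

Definition lin_tgd Sigma s : set (tgd (stype P)) :=
  [set s' | exists t h g,
     [/\ guard s = Some g, is_stype Sigma t,
         forall a, a \in tgd_body s -> amap h a \in tatoms t,
         amap h g = tguard t &
         s' = linearization Sigma s t h g]].

Definition lin Sigma : set (tgd (stype P)) :=
  \bigcup_(s in [set` Sigma]) lin_tgd Sigma s.

End Linearization.

(* Main.v *)
Require Import Defs.
From HB Require Import structures.
From mathcomp Require Import all_boot finmap.
From mathcomp Require Import all_classical.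
From mathcomp Require Import zify.

Set Implicit Arguments.
Unset Strict Implicit.
Unset Printing Implicit Defensive.

Local Open Scope classical_set_scope.

(* Every atom of the linear chase has the form [tau](w) where tau is the type, in
   the chase of D, of an atom R(v) such that w and v agree up to the names of the
   TGDs in their nulls; in particular they have the same depths. Conversely, every
   atom over the schema of Sigma is such an R(v). Both follow by induction from one
   step: the head types computed by the linearization of a trigger (s, h) are the
   types of the head atoms in the chase. They are sound because chasing commutes
   with substitution of constants. They are complete because, by guardedness, every
   atom containing a null created below (s, h) has all its terms below (s, h) or in
   the frontier, and is derived from the head and from atoms over the frontier,
   which belong to the type of the guard. Hence depths coincide, and
   each chase is finite exactly when its depths are bounded.
   Two linear nulls may correspond to one null and conversely (when TGDs have the
   same guard and head), so the correspondence of terms is a relation. *)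

(** * Terms and atoms *)

Lemma depth_Null (P : choiceType) x s (v : seq (term P)) :
  depth (Null x s v) = (\max_(u <- v) depth u).+1.
Proof. by rewrite unlock. Qed.

Lemma depth_lt_Null (P : choiceType) x s (v : seq (term P)) u :
  u \in v -> depth u < depth (Null x s v).
Proof. by move=> uv; rewrite depth_Null ltnS; apply: leq_bigmax_seq. Qed.

(* The generated induction principle gives no hypothesis on the values of a null. *)
Lemma term_nested_ind (P : choiceType) (Q : term P -> Prop) :
  (forall c, Q (Const c)) ->
  (forall x s v, (forall u, u \in v -> Q u) -> Q (Null x s v)) ->
  forall t, Q t.
Proof.
move=> QC QN t; have [n] := ubnP (depth t); elim: n t => // n IH [c _|x s v dn]; first exact: QC.
by apply: QN => u uv; apply: IH; apply: leq_trans (depth_lt_Null x s uv) _.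
Qed.

Lemma eq_amap (P T U : eqType) (f g : T -> U) (a : atom P T) :
  {in args a, f =1 g} -> amap f a = amap g a.
Proof. by move=> fg; rewrite /amap; congr Atom; apply/eq_in_map. Qed.

Lemma amap_comp (P T U V : Type) (f : U -> V) (g : T -> U) (a : atom P T) :
  amap f (amap g a) = amap (f \o g) a.
Proof. by rewrite /amap /= map_comp. Qed.

Lemma amap_id (P : Type) (T : eqType) (f : T -> T) (a : atom P T) :
  {in args a, f =1 id} -> amap f a = a.
Proof.
case: a => p u /= fid; rewrite /amap /=; congr Atom.
by rewrite -[RHS]map_id; apply/eq_in_map.
Qed.

Lemma dom_amap_preim (P : Type) (T U : eqType) (f : T -> U) (g : U -> T)
    (b : atom P U) :
  (forall u, u \in args b -> f (g u) = u) -> b = amap f (amap g b).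
Proof. by move=> fg; rewrite amap_comp amap_id. Qed.

(** * Frontiers, existential variables and guards *)

Section Tgd.
Variable P : choiceType.
Implicit Types s : tgd P.

Lemma mem_vars (A : seq (atom P var)) a x : a \in A -> x \in args a -> x \in vars A.
Proof. by move=> aA xa; apply/flattenP; exists (args a) => //; exact: map_f. Qed.

Lemma vars_mem (A : seq (atom P var)) x :
  x \in vars A -> exists2 a, a \in A & x \in args a.
Proof. by move/flattenP => [_ /mapP[a aA ->] xa]; exists a. Qed.

Lemma mem_fr s x :
  (x \in fr s) = (x \in vars (tgd_head s)) && (x \in vars (tgd_body s)).
Proof. by rewrite mem_filter mem_undup. Qed.

Lemma mem_exvars s x :
  (x \in exvars s) = (x \notin vars (tgd_body s)) && (x \in vars (tgd_head s)).
Proof. by rewrite mem_filter mem_undup. Qed.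

Lemma fr_body s x : x \in fr s -> x \in vars (tgd_body s).
Proof. by rewrite mem_fr => /andP[]. Qed.

Lemma head_exvars s a x :
  a \in tgd_head s -> x \in args a -> x \notin fr s -> x \in exvars s.
Proof. by move=> ah xa; rewrite mem_fr mem_exvars (mem_vars ah xa) /= andbT. Qed.

(** Nulls are indexed by the frontier values only: this is semi-obliviousness. *)
Lemma eq_mu s (h h' : var -> term P) :
  {in fr s, h =1 h'} -> mu s h = mu s h'.
Proof.
move=> hh; apply/funext => x; rewrite /mu; case: ifP => [/hh //|_].
by congr Null; apply/eq_in_map.
Qed.

Lemma guardP s : guarded s ->
  exists g, [/\ guard s = Some g, g \in tgd_body s
              & forall x, x \in vars (tgd_body s) -> x \in args g].
Proof.
rewrite /guarded /guard has_filter.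
case E: [seq _ <- _ | _] => [//|g l] _; exists g.
have : g \in [seq a <- tgd_body s | is_guard s a] by rewrite E mem_head.
by rewrite mem_filter => /andP[/allP gg gb].
Qed.

Lemma guard_spec s g : guard s = Some g ->
  g \in tgd_body s /\ forall x, x \in vars (tgd_body s) -> x \in args g.
Proof.
move=> E; have gs : guarded s.
  by move: E; rewrite /guarded /guard has_filter; case: [seq _ <- _ | _].
by have [g' []] := guardP gs; rewrite E => -[<-].
Qed.

End Tgd.

(** * The chase as an inductive closure *)

Section InductiveChase.
Variable P : choiceType.
Implicit Types (D : set (fact P)) (Sigma : set (tgd P)) (I J : instance P).

(** No order of triggers is fixed here, so properties of the chase follow by rule induction;
    [chaseE] identifies this set with [chase]. *)
Inductive derived D Sigma : instance P :=
  | derived_db a : D a -> derived D Sigma (amap Const a)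
  | derived_tgd s h a : Sigma s ->
      (forall b, b \in tgd_body s -> derived D Sigma (amap h b)) ->
      a \in tgd_head s -> derived D Sigma (amap (mu s h) a).

Definition tgd_closed Sigma J := forall s h, trigger Sigma J s h -> result s h `<=` J.

Lemma derived_closed D Sigma : tgd_closed Sigma (derived D Sigma).
Proof. by move=> s h [sS hb] _ [a ah <-]; apply: derived_tgd. Qed.

Lemma derived_min D Sigma J :
  inst_of D `<=` J -> tgd_closed Sigma J -> derived D Sigma `<=` J.
Proof.
move=> DJ cJ b; elim=> [a Da|s h a sS _ IH ah]; first by apply: DJ; exists a.
by apply: (cJ s h) => //; exists a.
Qed.

Lemma sub_trigger Sigma I J s h : I `<=` J -> trigger Sigma I s h -> trigger Sigma J s h.
Proof. by move=> IJ [sS hb]; split=> // a /hb /IJ. Qed.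

Lemma chase_step_sub Sigma I J : chase_step Sigma I J -> I `<=` J.
Proof. by move=> [s [h [_ ->]]]; apply: subsetUl. Qed.

Lemma chase_step_derived D Sigma I J :
  chase_step Sigma I J -> I `<=` derived D Sigma -> J `<=` derived D Sigma.
Proof.
move=> [s [h [[tr _] ->]]] ID; rewrite subUset; split=> //.
exact: derived_closed (sub_trigger ID tr).
Qed.

Lemma step_chain_mono Sigma (C : nat -> instance P) n :
  (forall i, i < n -> chase_step Sigma (C i) (C i.+1)) ->
  forall i j, i <= j <= n -> C i `<=` C j.
Proof.
move=> st i; elim=> [|j IH] /andP[ij jn]; first by move: ij; rewrite leqn0 => /eqP->.
move: ij; rewrite leq_eqVlt => /orP[/eqP-> //|]; rewrite ltnS => ij.
apply: subset_trans (chase_step_sub (st j jn)); apply: IH; lia.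
Qed.

Lemma step_chain_derived D Sigma (C : nat -> instance P) n :
  C 0 = inst_of D ->
  (forall i, i < n -> chase_step Sigma (C i) (C i.+1)) ->
  forall i, i <= n -> C i `<=` derived D Sigma.
Proof.
move=> C0 st; elim=> [|i IH] lin; last exact: chase_step_derived (st i lin) (IH (ltnW lin)).
by rewrite C0 => _ [a Da <-]; apply: derived_db.
Qed.

(* Bodies are finite, so a trigger on the union of a chain is one on a member. *)
Lemma trigger_chain Sigma (C : nat -> instance P) s h :
  (forall i j, i <= j -> C i `<=` C j) ->
  trigger Sigma (\bigcup_i C i) s h -> exists i, trigger Sigma (C i) s h.
Proof.
move=> mono [sS hb].
suff [i Hi] : exists i, forall a, a \in tgd_body s -> C i (amap h a) by exists i.
elim: (tgd_body s) hb => [|b l IH] hb; first by exists 0.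
have [i Hi] : exists i, forall a, a \in l -> C i (amap h a).
  by apply: IH => a al; apply: hb; rewrite inE al orbT.
have [j _ Hj] := hb b (mem_head _ _).
exists (maxn i j) => a; rewrite inE => /orP[/eqP->|al].
  exact: mono (leq_maxr i j) _ Hj.
exact: mono (leq_maxl i j) _ (Hi _ al).
Qed.

(** Closure under the TGDs is the point. A finite derivation ends without active trigger; in an
    infinite one, a trigger on the union is one on some stage and inactive later by fairness, so its
    result is contained there. *)
Lemma derivation_result_derived D Sigma J :
  derivation_result D Sigma J -> J = derived D Sigma.
Proof.
case=> [[n [C [[C0 st na] ->]]]|[C [[C0 st fair] ->]]].
  have -> : \bigcup_(i in `I_n.+1) C i = C n.
    apply/seteqP; split; last by move=> a Ca; exists n => /=.
    by apply: bigcup_sub => i /= lin; apply: step_chain_mono st _ _ _; rewrite -ltnS lin leqnn.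
  apply/seteqP; split; first exact: step_chain_derived C0 st n (leqnn n).
  apply: derived_min; first by rewrite -C0; apply: step_chain_mono st _ _ _; rewrite leqnn.
  by move=> s h tr; apply: contrapT => nr; apply: (na s h).
have mono i j : i <= j -> C i `<=` C j.
  by move=> ij; apply: (@step_chain_mono Sigma C j) => //; rewrite ij leqnn.
apply/seteqP; split.
  by apply: bigcup_sub => i _; apply: (@step_chain_derived D Sigma C i).
apply: derived_min; first by rewrite -C0; apply: bigcup_sup.
move=> s h /(trigger_chain mono)[i tr].
have [ri|nri] := pselect (result s h `<=` C i).
  by apply: subset_trans ri _; apply: bigcup_sup.
have [//|j [ij nact]] := fair i s h.
suff rj : result s h `<=` C j by apply: subset_trans rj _; apply: bigcup_sup.
apply: contrapT => nrj; apply: nact; split=> //.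
exact: sub_trigger (mono _ _ (ltnW ij)) tr.
Qed.

(** * Finiteness of bounded-depth parts *)

Lemma finite_seqs_mem (T : eqType) (A : set T) n :
  finite_set A -> finite_set [set l : seq T | size l = n /\ {in l, forall x, A x}].
Proof.
move=> fA; elim: n => [|n IH].
  by apply: sub_finite_set (finite_set1 [::]) => l [/size0nil->].
apply: sub_finite_set (finite_image2 cons fA IH) => -[[]//|x l [/= [sl] Al]].
exists x; first exact/Al/mem_head.
by exists l => //; split=> // y yl; apply: Al; rewrite inE yl orbT.
Qed.

(** The values of a null of the chase occur in the chase too, as an induction on the depth
    requires. *)
Lemma derived_term D Sigma a0 t : derived D Sigma a0 -> t \in args a0 ->
  (exists a c, [/\ D a, c \in args a & t = Const c]) \/
  exists s x v, [/\ Sigma s, x \in vars (tgd_head s), t = Null x s v,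
     size v = size (fr s) & {in v, forall u, idom (derived D Sigma) u}].
Proof.
move=> H; elim: H t => [a Da|s h a sS hb IH ah] t /mapP[x xa ->]; first by left; exists a, x.
rewrite /mu; case: ifPn => xf.
  have [b bb xb] := vars_mem (fr_body xf).
  by apply: IH bb _ _; apply: map_f.
right; exists s, x, (map h (fr s)); split=> //; first exact: mem_vars ah xa.
  by rewrite size_map.
move=> u /mapP[y yf ->]; have [b bb yb] := vars_mem (fr_body yf).
by exists (amap h b); [exact: hb | exact: map_f].
Qed.

(** A null of depth at most [d.+1] is given by a TGD, a head variable and a list of terms of depth
    at most [d], as long as the frontier. *)
Lemma finite_depth_terms D Sigma d : finite_set D -> finite_set Sigma ->
  finite_set [set t | idom (derived D Sigma) t /\ depth t <= d].
Proof.
move=> fD fS; elim: d => [|d IH].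
  apply: (@sub_finite_set _ _ (\bigcup_(a in D) (Const @` dom a))).
    move=> t [[b bI tb] t0]; case: (derived_term bI tb) => [[a [c [Da ca ->]]]|].
      by exists a => //; exists c.
    by move=> [s [x [v [_ _ E _ _]]]]; rewrite E in t0.
  by apply: bigcup_finite => // a _; apply: finite_image; apply: finite_seq.
pose U : set (term P) := \bigcup_(a in D) (Const @` dom a).
pose W := \bigcup_(s in Sigma) [set Null x s v | x in [set` vars (tgd_head s)]
  & v in [set l | size l = size (fr s) /\ {in l, forall x,
      [set t | idom (derived D Sigma) t /\ depth t <= d] x}]].
apply: (@sub_finite_set _ _ (U `|` W)).
  move=> t [[b bI tb] td]; case: (derived_term bI tb) => [[a [c [Da ca ->]]]|].
    by left; exists a => //; exists c.
  move=> [s [x [v [sS xh E sv vI]]]]; right; exists s => //.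
  exists x => //; exists v => //; split=> // u uv; split; first exact: vI.
  by rewrite -ltnS; apply: leq_trans td; rewrite E; apply: depth_lt_Null.
rewrite finite_setU; split; apply: bigcup_finite => // s _.
  by apply: finite_image; apply: finite_seq.
by apply: finite_image2; [exact: finite_seq | exact: finite_seqs_mem].
Qed.

(** A depth bound leaves finitely many terms, and each atom outside the database is a head predicate
    applied to a list of them of fixed length. *)
Lemma finite_derived D Sigma : finite_set D -> finite_set Sigma ->
  finite_set (derived D Sigma) <->
  exists d, forall t, idom (derived D Sigma) t -> depth t <= d.
Proof.
move=> fD fS; split=> [fC|[d Hd]].
  have fI : finite_set (idom (derived D Sigma)).
    by apply: bigcup_finite => // a _; apply: finite_seq.
  exists (\max_(t <- fset_set (idom (derived D Sigma))) depth t) => t tI.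
  by apply: leq_bigmax_seq => //; rewrite in_fset_set // inE.
have fT := finite_depth_terms d fD fS.
pose W := \bigcup_(s in Sigma) \bigcup_(a in [set` tgd_head s])
  (Atom (psym a) @` [set l | size l = size (args a) /\ {in l, forall x,
      [set t | idom (derived D Sigma) t /\ depth t <= d] x}]).
apply: (@sub_finite_set _ _ (inst_of D `|` W)).
  move=> _ [a Da|s h a sS hb ah]; first by left; exists a.
  right; exists s => //; exists a => //; exists (map (mu s h) (args a)) => //=.
  split=> [|t tm]; first by rewrite size_map.
  suff tI : idom (derived D Sigma) t by split=> //; apply: Hd.
  by exists (amap (mu s h) a) => //; apply: derived_tgd.
rewrite finite_setU; split; first exact: finite_image.
apply: bigcup_finite => // s _; apply: bigcup_finite => [|a _]; first exact: finite_seq.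
by apply: finite_image; apply: finite_seqs_mem.
Qed.

(** * Existence of fair derivations *)

Definition rank (s : tgd P) (h : var -> term P) := \max_(x <- vars (tgd_body s)) depth (h x).

Definition next_spec Sigma I J :=
  exists s h, [/\ active Sigma I s h, J = I `|` result s h &
    forall s' h', active Sigma I s' h' -> rank s h <= rank s' h'].

Lemma next_ex Sigma I : (exists s h, active Sigma I s h) -> exists J, next_spec Sigma I J.
Proof.
move=> ex.
pose p n := `[< exists s h, active Sigma I s h /\ rank s h = n >].
have exn : exists n, p n by have [s [h act]] := ex; exists (rank s h); apply/asboolP; exists s, h.
case: (ex_minnP exn) => m /asboolP [s [h [act rm]]] minm.
exists (I `|` result s h), s, h; split=> // s' h' act'; rewrite rm; apply: minm.
by apply/asboolP; exists s', h'.
Qed.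

Definition next_inst Sigma I : instance P :=
  match pselect (exists J, next_spec Sigma I J) with
  | left ex => projT1 (cid ex)
  | right _ => I
  end.

Lemma next_instP Sigma I : (exists s h, active Sigma I s h) -> next_spec Sigma I (next_inst Sigma I).
Proof.
move=> /next_ex ex; rewrite /next_inst; case: pselect => // ex'.
by case: cid.
Qed.

(* Only finitely many triggers have a given rank, and a trigger is applied at most
   once: always applying an active trigger of minimal rank is thus fair. *)
Lemma greedy_fair D Sigma (C : nat -> instance P) i s h :
  finite_set D -> finite_set Sigma -> C 0 = inst_of D ->
  (forall i, next_spec Sigma (C i) (C i.+1)) ->
  active Sigma (C i) s h -> exists j, i < j /\ ~ active Sigma (C j) s h.
Proof.
move=> fD fS C0 st act; apply: contrapT => nex.
have actj j : i <= j -> active Sigma (C j) s h.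
  rewrite leq_eqVlt => /orP[/eqP <- //|ij]; apply: contrapT => nact.
  by apply: nex; exists j.
have step j : chase_step Sigma (C j) (C j.+1).
  by have [s1 [h1 [? ? _]]] := st j; exists s1, h1.
have mono j k : j <= k -> C j `<=` C k.
  by move=> jk; apply: (@step_chain_mono Sigma C k) => //; rewrite jk leqnn.
have CD j : C j `<=` derived D Sigma by apply: (@step_chain_derived D Sigma C j).
have ex j : exists p : tgd P * (var -> term P),
    [/\ active Sigma (C j) p.1 p.2, C j.+1 = C j `|` result p.1 p.2 &
        forall s' h', active Sigma (C j) s' h' -> rank p.1 p.2 <= rank s' h'].
  by have [s1 [h1 ?]] := st j; exists (s1, h1).
have [sq Hsq] := choice ex.
(* A trigger is recorded by its TGD and its values on the body. With [(s, h)] active forever, these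
   codes are pairwise distinct elements of the finite set [K]. *)
pose code j := ((sq (i + j)).1, map (sq (i + j)).2 (vars (tgd_body (sq (i + j)).1))).
pose T := [set t | idom (derived D Sigma) t /\ depth t <= rank s h].
pose K := \bigcup_(s in Sigma) (pair s @` [set l | size l = size (vars (tgd_body s)) /\
            {in l, forall x, T x}]).
have fK : finite_set K.
  apply: bigcup_finite => // s1 _; apply: finite_image; apply: finite_seqs_mem.
  exact: finite_depth_terms.
have codeK j : K (code j).
  have [[[sS hb] _] _ rk] := Hsq (i + j).
  exists (sq (i + j)).1 => //; eexists; last by [].
  split; first by rewrite size_map.
  move=> t /mapP[x xb ->]; split.
    have [b bb xa] := vars_mem xb; exists (amap (sq (i + j)).2 b); last exact: map_f.
    exact: CD (hb b bb).
  (* [(s, h)] is still active, so the chosen trigger, of minimal rank, ranks no higher. *)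
  apply: leq_trans (rk s h (actj _ (leq_addr _ _))).
  exact: (leq_bigmax_seq (F := fun x => depth ((sq (i + j)).2 x))).
have code_neq j k : j < k -> code j <> code k.
  (* The result added at stage [i + j] stays, so a trigger with the same code is not active at
     [i + k]. *)
  move=> jk [E1 E2]; have [_ CE _] := Hsq (i + j); have [[_ na] _ _] := Hsq (i + k).
  apply: na; apply: (@subset_trans _ (C (i + j).+1)); last by apply: mono; lia.
  rewrite CE; apply: (@subset_trans _ (result (sq (i + j)).1 (sq (i + j)).2)) => [|?]; last by right.
  rewrite /result -E1; suff -> : mu (sq (i + j)).1 (sq (i + j)).2 = mu (sq (i + j)).1 (sq (i + k)).2 by [].
  apply: eq_mu => x /fr_body xb; move: E2; rewrite -E1 => /eq_in_map; exact.
have inj : {in code @^-1` K &, injective code}.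
  move=> j k _ _ E; case: (ltngtP j k) => // jk; first by case: (code_neq _ _ jk).
  by case: (code_neq _ _ jk).
have /sub_finite_set fN := finite_preimage inj fK.
by apply: infinite_nat; apply: fN => j _; apply: codeK.
Qed.

Lemma derivation_result_ex D Sigma : finite_set D -> finite_set Sigma ->
  exists J, derivation_result D Sigma J.
Proof.
move=> fD fS; pose C := fix C i := if i is j.+1 then next_inst Sigma (C j) else inst_of D.
have [[n na]|nna] := pselect (exists n, ~ exists s h, active Sigma (C n) s h).
  pose p n := `[< ~ exists s h, active Sigma (C n) s h >].
  have exn : exists n, p n by exists n; apply/asboolP.
  case: (ex_minnP exn) => m /asboolP nam minm; eexists; left; exists m, C.
  split; last by []; split=> // [i im|s h act]; last by apply: nam; exists s, h.
  have [//|s [h [? ? _]]] := @next_instP Sigma (C i); last by exists s, h.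
  apply: contrapT => na'; move: im; rewrite ltnNge => /negP; apply; apply: minm.
  exact/asboolP.
have st i : next_spec Sigma (C i) (C i.+1).
  by apply: next_instP; apply: contrapT => na; apply: nna; exists i.
eexists; right; exists C; split; last by []; split=> // [i|i s h act].
  by have [s [h [? ? _]]] := st i; exists s, h.
exact: (@greedy_fair D Sigma).
Qed.

(** [chase] is a union over the results of derivations, which would be empty if there were none:
    hence the construction of a fair one. *)
Lemma chaseE D Sigma : finite_set D -> finite_set Sigma ->
  chase D Sigma = derived D Sigma.
Proof.
move=> fD fS; apply/seteqP; split.
  by apply: bigcup_sub => J /derivation_result_derived ->.
have [J HJ] := derivation_result_ex fD fS.
by rewrite -(derivation_result_derived HJ); apply: bigcup_sup.
Qed.

End InductiveChase.

(** * Well-formed atoms over the schema *)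

Section Schema.
Variables (P : choiceType) (ar : P -> nat).
Implicit Types (Sigma : {fset tgd P}) (s : tgd P).

Lemma mem_sch Sigma s a :
  s \in Sigma -> a \in tgd_body s ++ tgd_head s -> psym a \in sch Sigma.
Proof. by move=> sS aS; apply/allpairsPdep; exists s, a. Qed.

Lemma body_sch Sigma s a : s \in Sigma -> a \in tgd_body s -> psym a \in sch Sigma.
Proof. by move=> sS ab; apply: mem_sch sS _; rewrite mem_cat ab. Qed.

Lemma head_sch Sigma s a : s \in Sigma -> a \in tgd_head s -> psym a \in sch Sigma.
Proof. by move=> sS ab; apply: mem_sch sS _; rewrite mem_cat ab orbT. Qed.

Lemma leq_max_ar Sigma p : p \in sch Sigma -> ar p <= max_ar ar Sigma.
Proof. by move=> pS; apply: (leq_bigmax_seq (F := ar)). Qed.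

Lemma amap_wf (T U : Type) (f : T -> U) (a : atom P T) :
  atom_wf ar (amap f a) = atom_wf ar a.
Proof. by rewrite /atom_wf size_map. Qed.

Lemma head_wf s a : tgd_wf ar s -> a \in tgd_head s -> atom_wf ar a.
Proof. by case/and3P => _ _ /allP wf ah; apply: wf; rewrite mem_cat ah orbT. Qed.

Lemma derived_wf D Sigma b : {in Sigma, forall s, tgd_wf ar s} ->
  (forall a, D a -> atom_wf ar a) -> derived D [set` Sigma] b -> atom_wf ar b.
Proof.
move=> wS wD; case=> [a /wD|s h a sS _ ah]; rewrite amap_wf //.
by move=> *; apply: head_wf ah; apply: wS.
Qed.

Lemma finite_atoms Sigma (T : eqType) (A : set T) : finite_set A ->
  finite_set [set b : atom P T | [/\ atom_wf ar b, psym b \in sch Sigma & dom b `<=` A]].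
Proof.
move=> fA; pose W := \bigcup_(p in [set` sch Sigma])
  (Atom p @` [set l | size l = ar p /\ {in l, forall x, A x}]).
apply: (@sub_finite_set _ _ W) => [[p u] [/eqP wf pS dA]|].
  by exists p => //; exists u => //; split=> // x xu; apply: dA.
apply: bigcup_finite => [|p _]; first exact: finite_seq.
by apply: finite_image; apply: finite_seqs_mem.
Qed.

End Schema.

(** * Renaming by order of first occurrence *)

Lemma rho_gt0 u k : 0 < rho u k. Proof. by []. Qed.

(** [k] and the distinct integers before its first occurrence all occur before position
    [index l u]. *)
Lemma rho_lt u k l : k \in u -> index k u < index l u -> rho u k < rho u l.
Proof.
move=> ku kl; rewrite /rho ltnS.
have /uniq_leq_size : uniq (k :: undup (take (index k u) u)).
  rewrite /= undup_uniq mem_undup andbT; apply/negP => /(nthP 0)[i].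
  rewrite size_take index_mem ku => ik; rewrite nth_take // => E.
  by move: (before_find 0 ik); rewrite /= E eqxx.
apply => x; rewrite inE !mem_undup => /orP[/eqP->|/(nthP 0)[i]].
  rewrite -{1}(nth_index 0 ku) -(nth_take 0 kl) mem_nth // size_take.
  by case: ifP => // _; rewrite index_mem.
rewrite size_take index_mem ku => ik; rewrite nth_take // => <-.
rewrite -(nth_take 0 (ltn_trans ik kl)) mem_nth // size_take; case: ifP => _; first exact: ltn_trans ik kl.
by rewrite (ltn_trans ik) // index_mem.
Qed.

Lemma rho_inj u : {in u &, injective (rho u)}.
Proof.
move=> k l ku lu E; case: (ltngtP (index k u) (index l u)) => [kl|lk|ekl].
- by have := rho_lt ku kl; rewrite E ltnn.
- by have := rho_lt lu lk; rewrite E ltnn.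
- by rewrite -(nth_index 0 ku) ekl nth_index.
Qed.

Definition unrho (u : seq nat) (k : nat) := nth 0 u (index k (map (rho u) u)).

Lemma rhoK u : {in u, cancel (rho u) (unrho u)}.
Proof.
move=> j ju; have rj : rho u j \in map (rho u) u by apply: map_f.
have := nth_index 0 rj; rewrite -index_mem size_map in rj.
rewrite (nth_map 0) // => /rho_inj; apply=> //; exact: mem_nth.
Qed.

(** If the integer at [i] occurred before, its new name did too. Otherwise the distinct integers
    before [i] have distinct names between 1 and the maximum, which bounds their number. *)
Lemma rho_normal u i : 0 < i < size u ->
  rho u (nth 0 u i) <= (\max_(k <- take i (map (rho u) u)) k).+1.
Proof.
move=> /andP[i0 iu]; have ui := mem_nth 0 iu.
have [lti|gei] := ltnP (index (nth 0 u i) u) i.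
  apply: leqW; apply: (leq_bigmax_seq (F := fun k => k)) => //.
  rewrite -map_take; apply/mapP; exists (nth 0 u i) => //.
  by rewrite -{1}(nth_index 0 ui) -(nth_take 0 lti) mem_nth // size_take iu.
have ei : index (nth 0 u i) u = i.
  by apply/eqP; rewrite eqn_leq gei andbT leqNgt; apply/negP => /(before_find 0); rewrite /= eqxx.
rewrite /rho ei ltnS -(size_map (rho u)).
set r := map _ _; set M := \max_(k <- _) k.
have ur : uniq r.
  rewrite map_inj_in_uniq ?undup_uniq // => k l; rewrite !mem_undup => /mem_take ku /mem_take lu.
  exact: rho_inj.
have /(uniq_leq_size ur) : {subset r <= iota 1 M}.
  move=> _ /mapP[k kt ->]; rewrite mem_iota rho_gt0 add1n ltnS /=.
  apply: (leq_bigmax_seq (F := fun k => k)) => //; rewrite -map_take; apply: map_f.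
  by rewrite mem_undup in kt.
by rewrite size_iota.
Qed.

(** * Sigma-types obtained by renaming *)

Section NormalType.
Variables (P : choiceType) (ar : P -> nat).
Implicit Types (Sigma : {fset tgd P}) (alpha : fact P) (S : set (fact P)).

(** Common form of the head types of linearizations and of the types of database facts, so that
    [matched_norm] serves both. *)
Definition norm_type alpha S : stype P :=
  let r := amap (rho (args alpha)) in
  (r alpha, [fset r b | b in fset_set (S `\ alpha)]%fset).

Definition typable Sigma alpha S :=
  [/\ 0 < ar (psym alpha), atom_wf ar alpha, psym alpha \in sch Sigma &
      forall b, S b -> [/\ atom_wf ar b, psym b \in sch Sigma & dom b `<=` dom alpha]].

Lemma typable_finite Sigma alpha S : typable Sigma alpha S -> finite_set S.
Proof.
move=> [_ _ _ HS]; apply: sub_finite_set (finite_atoms ar Sigma (finite_seq (args alpha))) => b.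
exact: HS.
Qed.

Lemma tatoms_norm Sigma alpha S b : typable Sigma alpha S ->
  reflect (exists2 c, c = alpha \/ S c & b = amap (rho (args alpha)) c)
          (b \in tatoms (norm_type alpha S)).
Proof.
move=> /typable_finite fS; have fS' : finite_set (S `\ alpha) by apply: finite_setD.
apply: (iffP idP).
  rewrite inE => /orP[|/imfsetP[c /= cS ->]].
    by rewrite inE => /eqP ->; exists alpha => //; left.
  by rewrite in_fset_set // inE in cS; case: cS => cS _; exists c => //; right.
move=> [c [->|Sc] ->]; first by rewrite inE /= in_fset1 eqxx.
have [->|ca] := eqVneq c alpha; first by rewrite inE /= in_fset1 eqxx.
rewrite inE; apply/orP; right; apply/imfsetP; exists c => //=.
by rewrite in_fset_set // inE; split=> //; apply/eqP.
Qed.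

Lemma norm_type_stype Sigma alpha S : typable Sigma alpha S ->
  is_stype ar Sigma (norm_type alpha S).
Proof.
move=> ty; have fS := typable_finite ty; case: (ty) => ar0 wfa sa HS; split.
- by rewrite amap_wf.
- move: wfa ar0; rewrite /atom_wf /=; case: (args alpha) => [/eqP <- //|x u _ _].
  by rewrite /rho /= eqxx.
- move=> i; rewrite size_map => iu; rewrite (nth_map 0) ?rho_normal //.
  by case/andP: iu.
- move=> b /imfsetP[c /=]; rewrite in_fset_set ?inE; last exact: finite_setD.
  move=> [/HS[wfc sc dc] _] ->; split=> //; first by rewrite amap_wf.
  move=> _ /mapP[k kc ->]; apply: map_f; exact: dc.
(* [rho] is injective on the integers of [alpha], so among atoms over them only [alpha] is renamed
   to the guard. *)
- apply/negP => /imfsetP[c /=]; rewrite in_fset_set ?inE; last exact: finite_setD.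
  move=> [/HS[_ _ dc] ca] [E1 E2]; apply: ca; case: c dc E1 E2 => p u dc /= E1 E2.
  case: alpha dc E1 E2 {ty fS ar0 wfa sa HS} => q v dc /= -> E; congr Atom.
  by apply: (inj_in_map (@rho_inj v)) (esym E); apply/allP => // x; apply: dc.
Qed.

(** Restricted growth from 1 bounds the argument at position [j], counted from 0, by [j.+1].
    Integers of types thus never meet those above [max_ar] that name new nulls. *)
Lemma stype_le Sigma t k : is_stype ar Sigma t -> k \in args (tguard t) ->
  k <= max_ar ar Sigma.
Proof.
move=> [[/eqP wf tS] t0 tn _ _] /(nthP 0)[i isz <-].
apply: leq_trans (leq_max_ar ar tS); rewrite -wf.
suff H j : j <= i -> nth 0 (args (tguard t)) j <= j.+1 by apply: leq_trans (H i _) _.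
have [n] := ubnP j; elim: n j => // n IH [_ _|j jn ji]; first by rewrite t0.
have /andP[_ le] : 1 <= nth 0 (args (tguard t)) j.+1 <=
   (\max_(k <- take j.+1 (args (tguard t))) k).+1 by apply: tn; rewrite /= (leq_ltn_trans ji isz).
apply: leq_trans le _; rewrite ltnS; apply/bigmax_leqP_seq => x /(nthP 0)[l].
rewrite size_take (leq_ltn_trans ji isz) => ls <- _; rewrite nth_take //.
by apply: leq_trans (IH l _ _) _; lia.
Qed.

Lemma stype_tatoms Sigma t b : is_stype ar Sigma t -> b \in tatoms t ->
  [/\ atom_wf ar b, psym b \in sch Sigma & {subset args b <= args (tguard t)}].
Proof.
move=> [[wf sg] _ _ H _] /fset1UP[->|/H[wfb sb db]]; split=> // k.
Qed.

(** The integers are bounded by [max_ar], so guards come from a finite set of atoms and side sets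
    are among its subsets. *)
Lemma finite_stypes Sigma : finite_set [set t | is_stype ar Sigma t].
Proof.
pose A := [set b : fact P | [/\ atom_wf ar b, psym b \in sch Sigma &
  dom b `<=` `I_((max_ar ar Sigma).+1)]].
have fA : finite_set A by apply: finite_atoms; apply: finite_II.
pose F := fset_set A.
apply: (@sub_finite_set _ _ (A `*` [set` fpowerset F])); last first.
  by apply: finite_setX => //; apply: finite_fset.
move=> t ty; have gA b : b \in tatoms t -> A b.
  move=> /(stype_tatoms ty)[wf sb db]; split=> // k /db kg.
  by rewrite /= ltnS (stype_le ty).
split; first by apply: gA; rewrite inE /= in_fset1 eqxx.
rewrite /= fpowersetE; apply/fsubsetP => b bt; rewrite in_fset_set // inE.
by apply: gA; rewrite inE bt orbT.
Qed.

End NormalType.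

(** * Substitution of constants in the chase *)

Section Morphism.
Variable P : choiceType.
Implicit Types (D : set (fact P)) (Sigma : set (tgd P)) (J : instance P).

Fixpoint subst_const (f : const -> term P) (t : term P) : term P :=
  match t with
  | Const c => f c
  | Null x s v => Null x s (map (subst_const f) v)
  end.

Lemma subst_const_mu f s h x :
  subst_const f (mu s h x) = mu s (subst_const f \o h) x.
Proof. by rewrite /mu; case: ifP => //= _; rewrite -map_comp. Qed.

(** TGDs are constant-free, so the substitution turns triggers into triggers and the nulls they
    create into those of the image trigger. *)
Lemma derived_subst_const D Sigma J f b : tgd_closed Sigma J ->
  (forall a, D a -> J (amap f a)) ->
  derived D Sigma b -> J (amap (subst_const f) b).
Proof.
move=> cJ DJ; elim=> [a Da|s h a sS _ IH ah].
  by rewrite amap_comp; have := DJ a Da.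
apply: (cJ s (subst_const f \o h)).
  by split=> // c cb; rewrite -amap_comp; apply: IH.
exists a => //; rewrite amap_comp; apply: eq_amap => x _.
by rewrite [RHS]/= subst_const_mu.
Qed.

End Morphism.

(** * The subtree below a trigger *)

Section Below.
Variable P : choiceType.
Implicit Types (D I : set (fact P)) (Sigma : {fset tgd P}).
Variables (s : tgd P) (h : var -> term P) (k : var -> const).

Let hv := map h (fr s).

Fixpoint below (t : term P) : bool :=
  if t is Null _ s1 v then ((s1 == s) && (v == hv)) || has below v else false.

(* Names the nulls of the trigger and the values of its frontier by constants,
   hereditarily; the nulls have precedence but never clash with the frontier. *)
Fixpoint encode (t : term P) : term P :=
  let frontier := Const (k (nth 0 (fr s) (index t hv))) in
  match t with
  | Const _ => if t \in hv then frontier else t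
  | Null x s1 v =>
      if (s1 == s) && (v == hv) then Const (k x)
      else if t \in hv then frontier else Null x s1 (map encode v)
  end.

Lemma depth_below t : below t -> \max_(u <- hv) depth u < depth t.
Proof.
elim/term_nested_ind: t => [//|x s1 v IH] /= /orP[/andP[_ /eqP->]|/hasP[u uv bu]].
  by rewrite -/(depth (Null x s1 hv)) depth_Null.
exact: ltn_trans (IH u uv bu) (depth_lt_Null x s1 uv).
Qed.

(** A term below the trigger is deeper than every frontier value. *)
Lemma below_frontier t : t \in hv -> below t = false.
Proof.
move=> tv; apply/negP => /depth_below; rewrite ltnNge => /negP; apply.
exact: leq_bigmax_seq.
Qed.

Hypothesis k_fr : {in fr s &, forall x y, h x = h y -> k x = k y}.

Lemma encode_fr x : x \in fr s -> encode (h x) = Const (k x).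
Proof.
move=> xf; have hxv : h x \in hv by apply: map_f.
(* [index] finds the first frontier variable with value [h x], maybe not [x]; by [k_fr] both have
   the same constant. *)
have E : Const (k (nth 0 (fr s) (index (h x) hv))) = Const (k x) :> term P.
  congr Const; apply: k_fr => //.
    by apply: mem_nth; rewrite -(size_map h) index_mem.
  by rewrite -(nth_map _ (Const 0)) ?nth_index // -(size_map h) index_mem.
have := below_frontier hxv; move: hxv E; case: (h x) => [c|y s1 v] /= -> E.
  by rewrite E.
by case: andP => //= _ _; rewrite E.
Qed.

Lemma encode_mu x : encode (mu s h x) = Const (k x).
Proof.
rewrite /mu; case: ifP => [|_ /=]; first exact: encode_fr.
by rewrite !eqxx.
Qed.

(* A trigger reading terms below [s, h] has its whole body there, because of the
   guard; the part of the body over the frontier is assumed to be derived. *)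
Lemma derived_below D I Sigma :
  {in Sigma, forall s', guarded s'} -> s \in Sigma ->
  (forall a, a \in tgd_head s -> I (amap k a)) ->
  (forall b, derived D [set` Sigma] b -> psym b \in sch Sigma ->
     {subset args b <= hv} -> derived I [set` Sigma] (amap encode b)) ->
  forall b, derived D [set` Sigma] b -> has below (args b) ->
    {in args b, forall t, below t || (t \in hv)} /\
    derived I [set` Sigma] (amap encode b).
Proof.
move=> gS sS I_head I_fr b; elim=> [a _ /hasP[_ /mapP[c _ ->]]//|].
move=> s2 h2 a s2S hb IH ah /hasP[_ /mapP[x0 xa ->] b0].
(* If no frontier value of the last trigger is below, the term below is a null created now, so this
   trigger agrees with [(s, h)] on the frontier. *)
have [|nb] := boolP (has (below \o h2) (fr s2)); last first.
  move: b0; rewrite [mu s2 h2 x0]/mu; case: ifPn => [xf b0|_].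
    by case/negP: nb; apply/hasP; exists x0.
  rewrite /= has_map (negbTE nb) orbF => /andP[/eqP E /eqP hE].
  move: ah hE xa; rewrite E => ah hE xa; have -> : mu s h2 = mu s h.
    by apply: eq_mu => x xf; move/eq_in_map: hE; apply.
  split=> [_ /mapP[x xa' ->]|].
    rewrite {1 2}/mu; case: ifP => xf; first by rewrite map_f ?orbT.
    by rewrite /= !eqxx.
  have := @derived_db _ I [set` Sigma] _ (I_head a ah); rewrite !amap_comp.
  by congr (derived _ _ _); apply: eq_amap => x _; rewrite [RHS]/= encode_mu.
move=> /hasP[y yf /= by_].
have [g [_ gb gall]] := guardP (gS _ s2S).
have hg : has below (args (amap h2 g)).
  by apply/hasP; exists (h2 y) => //; apply/map_f/gall/fr_body.
have [gB _] := IH g gb hg.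
have bB x : x \in vars (tgd_body s2) -> below (h2 x) || (h2 x \in hv).
  by move=> xb; apply: gB; apply/map_f/gall.
have muB x : x \in args a -> below (mu s2 h2 x) || (mu s2 h2 x \in hv).
  rewrite /mu; case: ifP => [/fr_body/bB //|_ _] /=.
  by rewrite has_map; apply/orP; left; apply/orP; right; apply/hasP; exists y.
(* Body atoms with a term below are encoded by induction; the others lie over the frontier, where
   [I_fr] applies. *)
have tr : trigger [set` Sigma] (derived I [set` Sigma]) s2 (encode \o h2).
  split=> // c cb; rewrite -amap_comp.
  have [hc|hc] := boolP (has below (args (amap h2 c))); first by case: (IH c cb hc).
  apply: I_fr => [||_ /mapP[x xc ->]]; first exact: hb; first exact: body_sch cb.
  case/orP: (bB x (mem_vars cb xc)) => // bx; case/negP: hc.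
  by apply/hasP; exists (h2 x) => //; apply: map_f.
split=> [_ /mapP[x xa' ->]|]; first exact: muB.
rewrite amap_comp (@eq_amap _ _ _ _ (mu s2 (encode \o h2))) => [|x xa' /=].
  by apply: (derived_closed tr); exists a.
(* [encode] keeps the new null: since [h2 y] is below, its values are not [hv], and the null is
   itself below, hence not a frontier value. *)
rewrite /mu; case: ifP => // _ /=; case: ifPn => [/andP[_ /eqP hE]|_].
  have : h2 y \in hv by rewrite -hE map_f.
  by move/below_frontier; rewrite by_.
case: ifPn => [/below_frontier /=|_]; last by rewrite -map_comp.
rewrite has_map => /norP[_ /hasPn /(_ y yf)].
by rewrite /= by_.
Qed.

End Below.

(** * Simulation of the chase by its linearization *)

(** Values are matched by variable, not by position: the body of a linearization is the guard alone,
    which may list the frontier in another order. *)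
Inductive sim (P : choiceType) : term (stype P) -> term P -> Prop :=
  | sim_Const c : sim (Const c) (Const c)
  | sim_Null x s' s (h' : var -> term (stype P)) (h : var -> term P) :
      fr s' =i fr s -> (forall y, y \in fr s -> sim (h' y) (h y)) ->
      sim (Null x s' (map h' (fr s'))) (Null x s (map h (fr s))).

Lemma sim_depth (P : choiceType) (t' : term (stype P)) (t : term P) :
  sim t' t -> depth t' = depth t.
Proof.
elim=> // x s' s h' h ff _ IH; rewrite !depth_Null !big_map; congr S.
have pf : perm_eq (fr s') (fr s).
  by apply: uniq_perm => //; rewrite filter_uniq // undup_uniq.
rewrite (perm_big _ pf) /= big_seq [RHS]big_seq; exact: eq_bigr.
Qed.

Lemma map_unrho (T : Type) (F : nat -> T) (u : seq nat) :
  map (F \o unrho u) (map (rho u) u) = map F u.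
Proof. by rewrite -map_comp; apply/eq_in_map => j ju /=; rewrite rhoK. Qed.

(** * Types matched with atoms of the two chases *)

Section Linear.
Variables (P : choiceType) (ar : P -> nat) (Sigma : {fset tgd P}).
Hypothesis ar_gt0 : forall p, 0 < ar p.
Hypothesis wfS : {in Sigma, forall s, tgd_wf ar s}.
Hypothesis gS : {in Sigma, forall s, guarded s}.
Variable D : set (fact P).

Let J := derived D [set` Sigma].

Lemma derived_sch (E : set (fact P)) b : (forall a, E a -> psym a \in sch Sigma) ->
  derived E [set` Sigma] b -> psym b \in sch Sigma.
Proof. by move=> ES; case=> [a /ES|s h a sS _ ah] //; apply: head_sch sS ah. Qed.

(* [f] and [f'] read the integers of [t] in the chase and in the linear chase; [t]
   is then the type, in the chase, of the image of its guard under [f]. *)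
Definition matched (t : stype P) (f : nat -> term P) (f' : nat -> term (stype P)) : Prop :=
  [/\ is_stype ar Sigma t,
      forall k, k \in args (tguard t) -> sim (f' k) (f k),
      {in args (tguard t) &, injective f},
      forall b, b \in tatoms t -> J (amap f b) &
      forall b, psym b \in sch Sigma -> {subset args b <= map f (args (tguard t))} ->
        J b -> exists2 c, c \in tatoms t & b = amap f c].

(** [unrho] undoes the renaming, so the conditions can be checked on the original integers of
    [alpha]. *)
Lemma matched_norm alpha S F F' : typable ar Sigma alpha S ->
  (forall k, k \in args alpha -> sim (F' k) (F k)) ->
  {in args alpha &, injective F} ->
  (forall c, c = alpha \/ S c -> J (amap F c)) ->
  (forall b, psym b \in sch Sigma -> {subset args b <= map F (args alpha)} ->
     J b -> exists2 c, c = alpha \/ S c & b = amap F c) ->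
  matched (norm_type alpha S) (F \o unrho (args alpha)) (F' \o unrho (args alpha)).
Proof.
move=> ty FF' Finj SJ JS; set u := args alpha.
have amapE c : c = alpha \/ S c -> amap (F \o unrho u) (amap (rho u) c) = amap F c.
  move=> cS; rewrite amap_comp; apply: eq_amap => j jc /=; rewrite rhoK //.
  by case: cS jc => [->//|Sc]; case: ty => _ _ _ /(_ c Sc)[_ _ dc]; apply: dc.
split.
- exact: norm_type_stype.
- by move=> _ /mapP[j ju ->] /=; rewrite rhoK //; apply: FF'.
- by move=> _ _ /mapP[i iu ->] /mapP[j ju ->] /=; rewrite !rhoK // => /Finj ->.
- by move=> _ /(tatoms_norm _ ty)[c cS ->]; rewrite amapE //; apply: SJ.
- move=> b bs bsub bJ; have [||//|c cS ->] := JS b => //.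
    by rewrite map_unrho in bsub.
  exists (amap (rho u) c); last by rewrite amapE.
  by apply/(tatoms_norm _ ty); exists c.
Qed.

(** * One step of the simulation *)

Section Step.
Variables (s : tgd P) (t : stype P) (h : var -> nat) (g : atom P var).
Hypotheses (sS : s \in Sigma) (gs : guard s = Some g) (ty : is_stype ar Sigma t).
Hypothesis hb : forall a, a \in tgd_body s -> amap h a \in tatoms t.
Hypothesis hg : amap h g = tguard t.

Let K := lin_inst ar Sigma s t h.
Let s' := linearization ar Sigma s t h g.

Definition lin_set (alpha : fact P) : set (fact P) :=
  [set b | complete K [set` Sigma] (amap Const b) /\ dom b `<=` dom alpha].

Lemma lin_typeE a : lin_type ar Sigma s t h a =
  norm_type (amap (lin_f ar Sigma s h) a) (lin_set (amap (lin_f ar Sigma s h) a)).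
Proof. by []. Qed.

Lemma lin_inst_finite : finite_set K.
Proof.
rewrite finite_setU; split; last exact: finite_fset.
by apply: finite_image; apply: finite_seq.
Qed.

Lemma lin_inst_atom b : K b -> atom_wf ar b /\ psym b \in sch Sigma.
Proof.
case=> [[a ah <-]|bt]; last by case: (stype_tatoms ty bt).
by rewrite amap_wf (head_wf (wfS sS) ah); split=> //; apply: head_sch ah.
Qed.

Lemma lin_set_typable a : a \in tgd_head s ->
  typable ar Sigma (amap (lin_f ar Sigma s h) a) (lin_set (amap (lin_f ar Sigma s h) a)).
Proof.
move=> ah; split=> //; first by rewrite amap_wf (head_wf (wfS sS) ah).
  exact: head_sch ah.
move=> b [[]]; rewrite chaseE; [|exact: lin_inst_finite|exact: finite_fset].
move=> bK _ db; split=> //.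
  by rewrite -(amap_wf ar (@Const P)); apply: derived_wf bK => // c /lin_inst_atom[].
by apply: derived_sch bK => c /lin_inst_atom[].
Qed.

Lemma lin_type_stype a : a \in tgd_head s -> is_stype ar Sigma (lin_type ar Sigma s t h a).
Proof. by move=> ah; rewrite lin_typeE; apply: norm_type_stype; apply: lin_set_typable. Qed.

Lemma fr_guard x : x \in fr s -> x \in args g.
Proof. by move/fr_body; case: (guard_spec gs) => _; apply. Qed.

Lemma body_guard x : x \in args g -> h x \in args (tguard t).
Proof. by move=> xg; rewrite -hg; apply: map_f. Qed.

Lemma vars_linear_body : vars (tgd_body s') = args g.
Proof. by rewrite /vars /= cats0. Qed.

Lemma fr_linear : fr s' =i fr s.
Proof.
move=> x; rewrite !mem_fr vars_linear_body.
have -> : vars (tgd_head s') = vars (tgd_head s) by rewrite /vars -map_comp.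
case: (x \in vars _) => //=; have [gb gall] := guard_spec gs.
by apply/idP/idP => [|/gall//]; apply: mem_vars.
Qed.

Lemma lin_f_fr x : x \in fr s -> lin_f ar Sigma s h x = h x.
Proof. by rewrite /lin_f => ->. Qed.

(** Decodes the values of [lin_f]: those above [max_ar] number the existential variables from 1,
    whereas [nth] counts from 0. *)
Definition new_null (Q : Type) (f : nat -> term Q) (r : tgd Q) (v : seq (term Q)) (k : nat) :=
  if k <= max_ar ar Sigma then f k
  else Null (nth 0 (exvars s) (k - max_ar ar Sigma).-1) r v.

Lemma new_nullE (Q : choiceType) (f : nat -> term Q) (r : tgd Q) a x :
  fr r =i fr s -> a \in tgd_head s -> x \in args a ->
  new_null f r (map (f \o h) (fr r)) (lin_f ar Sigma s h x) = mu r (f \o h) x.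
Proof.
move=> rf ah xa; rewrite /mu rf /new_null /lin_f; case: (boolP (x \in fr s)) => xf.
  by rewrite (stype_le ty) // body_guard // fr_guard.
by rewrite leqNgt addnS ltnS leq_addr /= subSn ?leq_addr // addKn /= nth_index // (head_exvars ah).
Qed.

(** The point is that the head type, computed from the finite [K] alone, is the type of the head
    atom in the chase of [D]. *)
Lemma matched_step f f' a : matched t f f' -> a \in tgd_head s ->
  exists F F', [/\ matched (lin_type ar Sigma s t h a) F F',
    map F (args (tguard (lin_type ar Sigma s t h a))) = map (mu s (f \o h)) (args a) &
    map F' (args (tguard (lin_type ar Sigma s t h a))) = map (mu s' (f' \o h)) (args a)].
Proof.
move=> [_ simf finj tJ Jt] ah; pose h0 := f \o h; pose k := lin_f ar Sigma s h.
pose F := new_null f s (map h0 (fr s)).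
pose F' := new_null f' s' (map (f' \o h) (fr s')).
have FE b x : b \in tgd_head s -> x \in args b -> F (k x) = mu s h0 x.
  by move=> bh xb; rewrite /F (new_nullE _ _ bh).
have F'E x : x \in args a -> F' (k x) = mu s' (f' \o h) x.
  by move=> xa; rewrite /F' (new_nullE _ fr_linear ah).
have Ff b : b \in tatoms t -> amap F b = amap f b.
  move=> bt; apply: eq_amap => j jb; rewrite /F /new_null (stype_le ty) //.
  by case: (stype_tatoms ty bt) => _ _; apply.
have tr : trigger [set` Sigma] J s h0.
  by split=> // b bb; rewrite -amap_comp; apply/tJ/hb.
have headJ b : b \in tgd_head s -> J (amap F (amap k b)).
  move=> bh; rewrite amap_comp (@eq_amap _ _ _ _ (mu s h0)) => [|x xb /=]; last exact: FE xb.
  by apply: (derived_closed tr); exists b.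
have k_fr : {in fr s &, forall x y, h0 x = h0 y -> k x = k y}.
  move=> x y xf yf; rewrite /k !lin_f_fr // => E.
  by apply: finj E; apply/body_guard/fr_guard.
have hv_guard : {subset map h0 (fr s) <= map f (args (tguard t))}.
  by move=> _ /mapP[x xf ->]; apply/map_f/body_guard/fr_guard.
(* Frontier values are terms of the guard, so such an atom is in the type [t], and its integer form
   is in [K]. *)
have I_fr b : J b -> psym b \in sch Sigma -> {subset args b <= map h0 (fr s)} ->
    derived K [set` Sigma] (amap (encode s h0 k) b).
  move=> bJ bs bsub; have [|c ct E] := Jt b bs _ bJ; first by move=> u /bsub /hv_guard.
  have -> : amap (encode s h0 k) b = amap Const c; last by apply: derived_db; right.
  rewrite E amap_comp; apply: eq_amap => j jc /=.
  have /mapP[x xf fj] : f j \in map h0 (fr s) by apply: bsub; rewrite E; apply: map_f.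
  have -> : j = h x.
    apply: finj fj; last exact/body_guard/fr_guard.
    by case: (stype_tatoms ty ct) => _ _; apply.
  by rewrite -[f (h x)]/(h0 x) encode_fr // /k lin_f_fr.
have typ := lin_set_typable ah.
exists (F \o unrho (map k (args a))), (F' \o unrho (map k (args a))).
rewrite lin_typeE; split; last 2 first.
- by rewrite map_unrho -map_comp; apply/eq_in_map => x xa /=; apply: FE xa.
- by rewrite map_unrho -map_comp; apply/eq_in_map => x xa /=; apply: F'E xa.
apply: matched_norm => //.
- move=> _ /mapP[x xa ->]; rewrite F'E // (FE a) // /mu fr_linear; case: ifP => xf.
    by apply: simf; apply/body_guard/fr_guard.
  by apply: sim_Null => [|y yf]; [exact: fr_linear | apply/simf/body_guard/fr_guard].
(* A new null is deeper than every frontier value, and two new nulls are told apart by their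
   variables. *)
- move=> _ _ /mapP[x xa ->] /mapP[y ya ->]; rewrite -!/(k _) !(FE a) // /mu.
  have nofr z w : z \in fr s -> h0 z <> Null w s (map h0 (fr s)).
    by move=> zf E; have := depth_lt_Null w s (map_f h0 zf); rewrite -E ltnn.
  case: ifP => xf; case: ifP => yf.
  + exact: k_fr.
  + by move/nofr => /(_ xf).
  + by move/esym/nofr => /(_ yf).
  + by move=> [->].
(* Soundness: reading constants through [F] maps the chase of [K] into [J]. *)
- move=> c [->|[[cK _] _]]; first exact: headJ.
  rewrite chaseE in cK; [|exact: lin_inst_finite|exact: finite_fset].
  have := derived_subst_const (f := F) (@derived_closed _ D _) _ cK.
  rewrite amap_comp; apply=> b [[b' bh <-]|bt]; first exact: headJ.
  by rewrite Ff //; apply: tJ.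
(* Completeness: [encode] maps an atom of [J] over the terms of the head atom into the chase of
   [K]. *)
- move=> b bs bsub bJ.
  have bmu u : u \in args b -> exists2 x, x \in args a & u = mu s h0 x.
    by move/bsub/mapP => [_ /mapP[x xa ->] ->]; exists x => //; apply: FE xa.
  have bK : derived K [set` Sigma] (amap (encode s h0 k) b).
    have [hB|nB] := boolP (has (below s h0) (args b)).
      have [] // := @derived_below _ s h0 k k_fr D K Sigma gS sS _ I_fr b bJ hB.
      by move=> c ch; left; exists c.
    apply: I_fr => // u ub; have [x xa E] := bmu u ub.
    move/hasPn/(_ u ub): nB; rewrite E /mu; case: ifP => [xf _|_ /=]; first exact: map_f.
    by rewrite !eqxx.
  (* The default 0 is never met: [encode] sends every term of the head atom to a constant. *)
  pose dec (u : term P) := if encode s h0 k u is Const c then c else 0.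
  have decE x : x \in args a -> dec (mu s h0 x) = k x by rewrite /dec encode_mu.
  exists (amap dec b); last first.
    apply: dom_amap_preim => u /bmu[x xa ->]; by rewrite decE // (FE a).
  right; split; last first.
    by move=> _ /mapP[_ /bmu[x xa ->] ->]; rewrite decE //; exact: map_f.
  split.
    rewrite chaseE; [|exact: lin_inst_finite|exact: finite_fset].
    rewrite amap_comp (@eq_amap _ _ _ _ (encode s h0 k)) // => _ /bmu[x xa ->] /=.
    by rewrite decE // encode_mu.
  (* [complete] also asks that the terms occur in [K]; they do, in the head atom [amap k a]. *)
  move=> _ /mapP[_ /mapP[_ /bmu[x xa ->] ->] ->]; rewrite decE //.
  exists (amap Const (amap k a)); last by do 2!apply: map_f.
  by exists (amap k a) => //; left; exists a.
Qed.

End Step.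
End Linear.

(** * Correspondence of the two chases *)

Section Simulation.
Variables (P : choiceType) (ar : P -> nat) (Sigma : {fset tgd P}).
Hypothesis ar_gt0 : forall p, 0 < ar p.
Hypothesis wfS : {in Sigma, forall s, tgd_wf ar s}.
Hypothesis gS : {in Sigma, forall s, guarded s}.
Variable D : {fset fact P}.
Hypothesis wfD : is_database ar D.

Let J := derived [set` D] [set` Sigma].
Let L := derived (lin_db ar [set` D] Sigma) (lin ar Sigma).

(** The maps [h] are infinitely many, but a linearization of [s] depends only on [t] and the list of
    its head types, all Sigma-types. *)
Lemma finite_lin : finite_set (lin ar Sigma).
Proof.
apply: bigcup_finite => [|s sS]; first exact: finite_fset.
have [g [gs _ _]] := guardP (gS sS).
pose W := [set Tgd [:: Atom t (args g)] [seq Atom p.1 (args p.2) | p <- zip l (tgd_head s)] |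
  t in [set t | is_stype ar Sigma t] &
  l in [set l | size l = size (tgd_head s) /\ {in l, forall t, [set t | is_stype ar Sigma t] t}]].
apply: (@sub_finite_set _ _ W).
  move=> _ [t [h [g' [gs' ty hb hg ->]]]]; exists t => //.
  exists (map (lin_type ar Sigma s t h) (tgd_head s)).
    split; first by rewrite size_map.
    by move=> _ /mapP[a ah ->]; apply: lin_type_stype ah.
  move: gs'; rewrite gs => -[<-]; rewrite /linearization; congr Tgd.
  by rewrite -[X in zip _ X]map_id zip_map -map_comp.
apply: finite_image2; first exact: finite_stypes.
by apply: finite_seqs_mem; apply: finite_stypes.
Qed.

Lemma finite_lin_db : finite_set (lin_db ar [set` D] Sigma).
Proof.
apply: (@sub_finite_set _ _ [set Atom t (args a) | t in [set t | is_stype ar Sigma t] & a in [set` D]]).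
  by move=> _ [a [t [[Da ty _ _ _] ->]]]; exists t => //; exists a.
by apply: finite_image2; [exact: finite_stypes | exact: finite_fset].
Qed.

Lemma same_pattern_map (T U : eqType) (x0 : U) (u : seq T) (v : seq U) :
  same_pattern u v -> map (fun k => nth x0 v (index k u)) u = v.
Proof.
move=> [sz pat]; apply: (@eq_from_nth _ x0); rewrite size_map // => i iu.
case: u sz pat iu => // y0 u; set w := y0 :: u => sz pat iu.
rewrite (nth_map y0) //; have wi := mem_nth y0 iu.
by apply/(pat y0 x0); rewrite ?index_mem // nth_index.
Qed.

Lemma same_pattern_inj (T U : eqType) (x0 : U) (u : seq T) (v : seq U) :
  same_pattern u v -> {in u &, injective (fun k => nth x0 v (index k u))}.
Proof.
move=> [sz pat] k l ku lu /=; rewrite -(pat k x0) ?index_mem //.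
by rewrite !nth_index.
Qed.

(** The equation in [lin_db] gives the last two conditions of [matched]. *)
Lemma lin_db_matched t w : lin_db ar [set` D] Sigma (Atom t w) ->
  exists f f', matched ar Sigma [set` D] t f f' /\ map Const w = map f' (args (tguard t)).
Proof.
move=> [a [t' [[Da ty sa pat typ] [E1 E2]]]]; rewrite {w}E2; move: t' E1 ty sa pat typ => _ <-.
move=> ty sa pat typ.
have patC (Q : Type) : same_pattern (args (tguard t)) (map (@Const Q) (args a)).
  case: pat => sz pat; split=> [|x0 y0 i j iu ju]; first by rewrite size_map.
  rewrite !(nth_map 0) -?sz // (pat x0 0) //.
  by split=> [->|[]].
pose fc (Q : Type) k := nth (Const 0) (map (@Const Q) (args a)) (index k (args (tguard t))).
exists (fc P), (fc (stype P)); rewrite same_pattern_map //; split=> //.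
have typE b : type_of [set` D] [set` Sigma] (amap Const a) b <->
    J b /\ dom b `<=` dom (amap Const a).
  by rewrite /type_of chaseE; [| exact: finite_fset | exact: finite_fset].
split=> //.
- move=> k kg; have ia : index k (args (tguard t)) < size (args a).
    by case: pat => <- _; rewrite index_mem.
  by rewrite /fc !(nth_map 0) //; apply: sim_Const.
- exact: same_pattern_inj.
- move=> b bt; have : inst_type t (map Const (args a)) (amap (fc P) b) by exists b.
  by rewrite typ => -[/typE[]].
- move=> b bs; rewrite same_pattern_map // => bsub bJ.
  have : inst_type t (map Const (args a)) b by rewrite typ; split=> //; apply/typE.
  by move=> [c ct <-]; exists c.
Qed.

(** The type is found by renaming the constants of [a]; its side atoms come from the chase, over
    those constants and the schema. *)
Lemma db_matched a : a \in D -> psym a \in sch Sigma ->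
  exists t f f', [/\ matched ar Sigma [set` D] t f f', amap Const a = amap f (tguard t) &
    L (Atom t (map f' (args (tguard t))))].
Proof.
move=> aD sa; pose S := [set b : fact P | [/\ J (amap Const b), psym b \in sch Sigma & dom b `<=` dom a]].
have typ : typable ar Sigma a S.
  split=> //; first exact: wfD.
  move=> b [bJ sb db]; split=> //; rewrite -(amap_wf ar (@Const P)).
  by apply: derived_wf bJ => // c; apply: wfD.
have M : matched ar Sigma [set` D] (norm_type a S) (Const \o unrho (args a)) (Const \o unrho (args a)).
  apply: matched_norm => //.
  - by move=> k _; apply: sim_Const.
  - by move=> k l _ _ [].
  - by move=> c [->|[]//]; apply: derived_db.
  - move=> b bs bsub bJ; pose dec (u : term P) := if u is Const c then c else 0.
    have decE u : u \in args b -> exists2 c, c \in args a & u = Const c.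
      by move/bsub/mapP => [c ca ->]; exists c.
    have bE : b = amap Const (amap dec b).
      by apply: dom_amap_preim => _ /decE[c _ ->].
    exists (amap dec b) => //; right; split; rewrite -?bE //.
    by move=> _ /mapP[_ /decE[c ca ->] ->].
have rhoE (Q : Type) : map (@Const Q \o unrho (args a)) (map (rho (args a)) (args a)) = map Const (args a).
  by rewrite map_unrho.
exists (norm_type a S), (Const \o unrho (args a)), (Const \o unrho (args a)); split=> //.
  by rewrite /amap /= rhoE.
rewrite /= rhoE; apply: (@derived_db _ _ _ (Atom (norm_type a S) (args a))).
exists a, (norm_type a S); split=> //; split=> //; first exact: norm_type_stype.
  split=> [|x0 y0 i j]; rewrite size_map // => ia ja; rewrite !(nth_map 0) //.
  rewrite !(set_nth_default 0 y0) //; split=> [|->//].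
  by move/rho_inj; apply; apply: mem_nth.
have instE c : c = a \/ S c -> amap (fun k => nth (Const 0) (map Const (args a))
    (index k (map (rho (args a)) (args a)))) (amap (rho (args a)) c) = amap (@Const P) c.
  move=> cS; rewrite amap_comp; apply: eq_amap => k kc /=.
  have ka : k \in args a by case: cS kc => [->//|[_ _ dc]]; apply: dc.
  rewrite (nth_map 0); last by rewrite -(size_map (rho (args a))) index_mem map_f.
  by congr Const; exact: rhoK.
have typE b : type_of [set` D] [set` Sigma] (amap Const a) b <->
    J b /\ dom b `<=` dom (amap Const a).
  by rewrite /type_of chaseE; [| exact: finite_fset | exact: finite_fset].
apply/seteqP; split=> [_ [_ /(tatoms_norm _ typ)[c cS ->] <-]|b [/typE[bJ db] sb]].
  rewrite instE //; split; last by case: cS => [->//|[]].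
  apply/typE; split; first by case: cS => [->|[]//]; apply: derived_db.
  move=> _ /mapP[k kc ->]; apply: map_f; case: cS kc => [->//|[_ _ dc]]; exact: dc.
have [_ _ _ _ /(_ b sb)[]] := M => //; first by rewrite /= rhoE.
move=> _ /(tatoms_norm _ typ)[c cS ->] ->; exists (amap (rho (args a)) c).
  by apply/(tatoms_norm _ typ); exists c.
rewrite instE // amap_comp; apply: eq_amap => k kc /=; rewrite rhoK //.
by case: cS kc => [->//|[_ _ dc]]; apply: dc.
Qed.

Lemma linear_matched b : L b ->
  exists f f', matched ar Sigma [set` D] (psym b) f f' /\ args b = map f' (args (tguard (psym b))).
Proof.
elim=> [[t w] /lin_db_matched //|s' h' a' [s sS [t [h [g [gs ty hb hg ->]]]]] _ IH].
move=> /mapP[a ah ->] /=.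
have [f [f' [M E]]] := IH _ (mem_head _ _).
have [F [F' [MF _ EF']]] := matched_step ar_gt0 wfS gS sS gs ty hb hg M ah.
exists F, F'; split=> //; rewrite EF'; congr map; apply: eq_mu => x xf.
have xg : x \in args g by move: xf; rewrite (fr_linear _ _ _ _ gs); apply: fr_guard gs _.
by move: E; rewrite -hg /= -map_comp => /eq_in_map; apply.
Qed.

(** The trigger is pulled back to the integers of the type [t] matched with its guard atom, which
    yields a linearization to apply. *)
Lemma derived_matched b : J b -> psym b \in sch Sigma ->
  exists t f f', [/\ matched ar Sigma [set` D] t f f', b = amap f (tguard t) &
    L (Atom t (map f' (args (tguard t))))].
Proof.
elim=> [a|s h0 a sS hb0 IH ah _]; first exact: db_matched.
have [g [gs gb gall]] := guardP (gS sS).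
have [t [f [f' [M E Lt]]]] := IH g gb (body_sch sS gb).
have [ty _ finj tJ Jt] := M; have [Ep Ea] : psym g = psym (tguard t) /\
  map h0 (args g) = map f (args (tguard t)) by case: E.
(* Each variable goes to the integer of [t] at its position in the guard; the default 0 is not
   reached on body variables. *)
pose h x := nth 0 (args (tguard t)) (index x (args g)).
have sz : size (args g) = size (args (tguard t)) by rewrite -(size_map h0) Ea size_map.
have hin x : x \in args g -> h x \in args (tguard t).
  by move=> xg; apply: mem_nth; rewrite -sz index_mem.
have fh x : x \in args g -> f (h x) = h0 x.
  move=> xg; rewrite -(nth_map 0 (Const 0)) -?sz ?index_mem // -Ea.
  by rewrite (nth_map x) ?index_mem // nth_index.
have hg : amap h g = tguard t.
  rewrite /amap Ep; case: (tguard t) Ea finj hin => p u /= Ea finj hin; congr Atom.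
  apply: (inj_in_map finj); [by apply/allP => _ /mapP[x xg ->]; exact: hin | exact/allP |].
  by rewrite -Ea -map_comp; apply/eq_in_map => x xg /=; apply: fh.
have hb c : c \in tgd_body s -> amap h c \in tatoms t.
  move=> cb; have cg x : x \in args c -> x \in args g by move=> xc; apply/gall/mem_vars/xc.
  (* The body atom lies over the terms of the guard, so it is the image of some [d] in the type;
     injectivity of [f] identifies [d]. *)
  have [|d dt E'] := Jt _ (body_sch sS cb : psym (amap h0 c) \in _) _ (hb0 c cb).
    by move=> _ /mapP[x xc ->]; rewrite -Ea; apply/map_f/cg.
  suff -> : amap h c = d by [].
  case: E' => Ep' Ea'; have [_ _ dg] := stype_tatoms ty dt.
  rewrite /amap Ep'; case: d dt dg Ep' Ea' => p u /= _ ug _ Ea'; congr Atom.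
  apply: (inj_in_map finj); [by apply/allP => _ /mapP[x xc ->]; apply/hin/cg | exact/allP |].
  by rewrite -Ea' -map_comp; apply/eq_in_map => x xc /=; apply/fh/cg.
have [F [F' [MF EF EF']]] := matched_step ar_gt0 wfS gS sS gs ty hb hg M ah.
exists (lin_type ar Sigma s t h a), F, F'; split=> //.
  rewrite [RHS]/amap EF /amap /=; congr Atom; congr map; apply: eq_mu => x xf /=.
  by rewrite fh // gall // fr_body.
rewrite EF'.
apply: (@derived_tgd _ _ _ (linearization ar Sigma s t h g) (f' \o h)
  (Atom (lin_type ar Sigma s t h a) (args a))); last exact: map_f.
  by exists s => //; exists t, h, g.
move=> c; rewrite inE => /eqP ->; move: Lt.
by rewrite -hg /amap /= -map_comp.
Qed.

(** * Transfer of depths and finiteness *)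

Lemma linear_term t' : idom L t' -> exists2 t, idom J t & depth t = depth t'.
Proof.
move=> [b /linear_matched[f [f' [[_ simf _ fJ _] E]]] tb].
move: tb; rewrite /dom /= E => /mapP[k kg ->]; exists (f k); last exact/esym/sim_depth/simf.
exists (amap f (tguard (psym b))); last exact: map_f.
by apply: fJ; exact: fset1U1.
Qed.

(* An atom over a predicate outside of the schema is a fact of the database. *)
Lemma derived_term_linear t : idom J t ->
  depth t = 0 \/ exists2 t', idom L t' & depth t' = depth t.
Proof.
move=> [b bJ tb]; have [sb|nsb] := boolP (psym b \in sch Sigma).
  have [u [f [f' [[_ simf _ _ _] E Lu]]]] := derived_matched bJ sb.
  move: tb; rewrite E => /mapP[k kg ->]; right; exists (f' k); last exact/sim_depth/simf.
  by exists (Atom u (map f' (args (tguard u)))) => //; apply: map_f.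
left; case: bJ tb nsb => [a _ /mapP[c _ ->] //|s h a sS _ ah _ /negP[]].
exact: head_sch sS ah.
Qed.

Lemma finite_linear : finite_set J <-> finite_set L.
Proof.
rewrite !finite_derived; try exact: finite_fset; [|exact: finite_lin_db|exact: finite_lin].
split=> -[d dP]; exists d => t; first by move=> /linear_term[u /dP + <-].
by case/derived_term_linear => [->|[u /dP + <-]].
Qed.

Lemma max_depth_linear : finite_set J ->
  \max_(t <- fset_set (idom J)) depth t = \max_(t <- fset_set (idom L)) depth t.
Proof.
move=> fJ; have fL : finite_set L by apply/finite_linear.
have fiJ : finite_set (idom J) by apply: bigcup_finite => // a _; apply: finite_seq.
have fiL : finite_set (idom L) by apply: bigcup_finite => // a _; apply: finite_seq.
apply/eqP; rewrite eqn_leq; apply/andP; split; apply/bigmax_leqP_seq => t.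
  rewrite in_fset_set // inE => /derived_term_linear[-> //|[u uL <-] _].
  by apply: leq_bigmax_seq => //; rewrite in_fset_set // inE.
rewrite in_fset_set // inE => /linear_term[u uJ <-] _.
by apply: leq_bigmax_seq => //; rewrite in_fset_set // inE.
Qed.

End Simulation.

Theorem proposition8p1 (P : choiceType) (ar : P -> nat)
    (ar_gt0 : forall p, 0 < ar p)
    (D : {fset fact P}) (hD : is_database ar D)
    (Sigma : {fset tgd P})
    (hSigma : forall s, s \in Sigma -> tgd_wf ar s /\ guarded s) :
  (CT [set` D] [set` Sigma] <->
     CT (lin_db ar [set` D] Sigma) (lin ar Sigma)) /\
  maxdepth [set` D] [set` Sigma] =
    maxdepth (lin_db ar [set` D] Sigma) (lin ar Sigma).
Proof.
have wfS : {in Sigma, forall s, tgd_wf ar s} by move=> s /hSigma[].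
have gS : {in Sigma, forall s, guarded s} by move=> s /hSigma[].
have fin := finite_linear ar_gt0 wfS gS hD.
rewrite /CT /maxdepth /= !chaseE; try exact: finite_fset;
  [|exact: finite_lin_db|exact: finite_lin].
split=> //; case: asboolP => [fJ|nfJ].
  by rewrite (asboolT (fin.1 fJ)) (max_depth_linear ar_gt0 wfS gS hD).
by rewrite asboolF // => fL; apply/nfJ/fin.
Qed.
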